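(* Let $(X,T)$ be a flow with $X$ a compact metric space, and suppose the induced flow $(2^X,T)$ is weakly almost periodic. Then the map $\Theta:E(2^X)\to E(X)$ defined by $\Theta(\alpha)=\alpha'$, where $\{\alpha'(x)\}=\alpha(\{x\})$ for all $x\in X$, is injective.
   Context: A flow $(X,T)$ is a continuous action of a discrete group $T$ on a compact space $X$; $\pi^t:X\to X$ is $x\mapsto tx$. $2^X$ is the space of all nonempty closed subsets of $X$ with the Vietoris (equivalently Hausdorff metric) topology; $(X,T)$ induces $(2^X,T)$ via $\pi^t_*(A)=\pi^t(A)$. For a flow $(Y,T)$, the enveloping semigroup $E(Y)$ is the closure of $\{\pi^t:t\in T\}$ in $Y^Y$ with the product topology. Every $\alpha\in E(2^X)$ maps singletons to singletons, and $\Theta$ is a well-defined map from $E(2^X)$ to $E(X)$. A flow $(Y,T)$ is weakly almost periodic (WAP) if for every $g\in\mathcal{C}(Y)$ (the space of continuous complex-valued functions on $Y$ with the topology of pointwise convergence) the set $\{g\circ\pi^t:t\in T\}$ is relatively compact in $\mathcal{C}(Y)$. *)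

(* Defs.v *)
From HB Require Import structures.
From mathcomp Require Import all_boot all_order all_algebra.
From mathcomp Require Import all_classical all_reals all_analysis.
From mathcomp Require Import finmap complex.

Set Implicit Arguments.
Unset Strict Implicit.
Unset Printing Implicit Defensive.

Import Order.TTheory GRing.Theory Num.Theory.
Import numFieldNormedType.Exports.

Local Open Scope classical_set_scope.
Local Open Scope ring_scope.

(* [act_continuous] is joint continuity on T * X with T discrete, and
   [act_compact] says that the phase space X is compact. *)
Record flow (T : groupType) (X : topologicalType) := Flow {
  act :> T -> X -> X;
  act1 : forall x, act 1%g x = x;
  actM : forall s t x, act (s * t)%g x = act s (act t x);
  act_continuous :
    continuous (fun p : discrete_topology T * X => act p.1 p.2);
  act_compact : compact [set: X] }.

(* The set 2^X. *)
Record hyperspace (X : topologicalType) := Hyperspace {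
  hset :> set X;
  hset_closed : closed hset;
  hset_neq0 : hset !=set0 }.

HB.instance Definition _ (X : topologicalType) := gen_eqMixin (hyperspace X).
HB.instance Definition _ (X : topologicalType) := gen_choiceMixin (hyperspace X).

Lemma hyperspace_eq (X : topologicalType) (A B : hyperspace X) :
  hset A = hset B -> A = B.
Proof.
case: A B => [A Ac A0] [B Bc B0] /= AB; move: Ac A0; rewrite AB => Ac A0.
by rewrite (Prop_irrelevance Ac Bc) (Prop_irrelevance A0 B0).
Qed.

Definition vietoris_contained (X : topologicalType) (U : set X) :=
  [set A : hyperspace X | A `<=` U].

Definition vietoris_hit (X : topologicalType) (U : set X) :=
  [set A : hyperspace X | A `&` U !=set0].

Definition vietoris_subbase (X : topologicalType) :
    set (set (hyperspace X)) :=
  [set vietoris_contained U | U in open] `|` [set vietoris_hit U | U in open].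

HB.instance Definition _ (X : topologicalType) :=
  isSubBaseTopological.Build (hyperspace X) (@vietoris_subbase X) id.

Section vietoris_theory.
Context {X : topologicalType}.
Implicit Types A : hyperspace X.

Lemma vietoris_subbase_open (C : set (hyperspace X)) :
  vietoris_subbase C -> open C.
Proof.
move=> sC; exists [set C]; last by rewrite bigcup_set1.
by move=> _ ->; apply: (@finI_from1 _ _ (@vietoris_subbase X) id).
Qed.

Lemma vietoris_contained_open (U : set X) :
  open U -> open (vietoris_contained U).
Proof. by move=> oU; apply: vietoris_subbase_open; left; exists U. Qed.

Lemma vietoris_hit_open (U : set X) : open U -> open (vietoris_hit U).
Proof. by move=> oU; apply: vietoris_subbase_open; right; exists U. Qed.

Lemma vietoris_cvgP (F : set_system (hyperspace X)) A : Filter F ->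
  F --> A <-> forall U, open U ->
    (A `<=` U -> F (vietoris_contained U)) /\
    (A `&` U !=set0 -> F (vietoris_hit U)).
Proof.
move=> FF; split=> [FA U oU|FA P].
  split=> AU; apply: FA; apply: open_nbhs_nbhs; split=> //.
    exact: vietoris_contained_open.
  exact: vietoris_hit_open.
rewrite nbhsE => -[_ [[D sD <-] [B DB BA]] sP]; apply: filterS sP _.
have [L sL LB] := sD _ DB; rewrite -LB in BA.
apply: (@filterS _ _ _ B); first by move=> C BC; exists B.
rewrite -LB; apply: filter_bigI => C LC.
have := BA C LC; have /set_mem := sL _ LC.
by case=> -[U oU <-] AU; [have [/(_ AU)] := FA _ oU|have [_ /(_ AU)] := FA _ oU].
Qed.

Lemma hyperspace_compact : compact [set: X] -> compact [set: hyperspace X].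
Proof.
move=> cX; rewrite compact_ultra => F FU _.
pose A := [set x | forall U, open U -> U x -> F (vietoris_hit U)].
have missF (K : set X) : compact K -> K `&` A = set0 ->
    F [set B : hyperspace X | forall x, K x -> ~ hset B x].
  move=> cK KA; have /compact_near_coveringP ncK := cK.
  apply: (ncK _ F (fun B x => ~ hset B x)) => x Kx.
  have [U [oU Ux FnU]] : exists U, [/\ open U, U x & ~ F (vietoris_hit U)].
    apply: contrapT => nU; have : (K `&` A) x; last by rewrite KA.
    split=> // U oU Ux; apply: contrapT => FnU.
    by apply: nU; exists U.
  have [//|FU'] := in_ultra_setVsetC (vietoris_hit U) FU.
  exists (U, ~` vietoris_hit U); first by split=> //=; apply: open_nbhs_nbhs.
  by move=> [y B] /= [Uy nB] By; apply: nB; exists y.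
have Acl : closed A.
  move=> x clx U oU Ux.
  have [y [Ay Uy]] := clx _ (open_nbhs_nbhs (conj oU Ux)).
  exact: Ay.
have A0 : A !=set0.
  apply/set0P/eqP => A0; have TA : [set: X] `&` A = set0 by rewrite A0 setI0.
  have /filter_ex[B nB] := missF _ cX TA.
  by have [x Bx] := hset_neq0 B; exact: (nB x).
exists (Hyperspace Acl A0); split=> //.
apply/vietoris_cvgP => U oU; split=> /= [AU|[x [Ax Ux]]]; last exact: Ax.
have cU : compact (~` U).
  by apply: (subclosed_compact _ cX) => //; exact: open_closedC.
have FCU : F [set B : hyperspace X | forall x, (~` U) x -> ~ hset B x].
  by apply: missF => //; rewrite -subset0 => x [nUx /AU].
apply: filterS FCU => B nB x Bx; apply: contrapT => nUx.
exact: (nB x).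
Qed.

End vietoris_theory.

Section hyperflow.
Context {T : groupType} {X : topologicalType} (phi : flow T X).

Lemma act_continuousr t : continuous (phi t).
Proof.
move=> x V /(@act_continuous _ _ phi (t, x)) [[A B] /= [At Bx] sAB].
rewrite nbhs_simpl /=; apply: filterS Bx => y By; apply: (sAB (t, y)); split=> //=.
exact: (@nbhs_singleton (discrete_topology T)).
Qed.

Lemma actK t : cancel (phi t) (phi t^-1%g).
Proof. by move=> x; rewrite -actM mulVg act1. Qed.

Lemma actVK t : cancel (phi t^-1%g) (phi t).
Proof. by move=> x; rewrite -actM mulgV act1. Qed.

Lemma act_image_closed t (A : hyperspace X) : closed (phi t @` A).
Proof.
suff -> : phi t @` A = phi t^-1%g @^-1` A.
  apply: preimage_closed; last exact: hset_closed.
  by move=> x _; exact: act_continuousr.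
apply/seteqP; split=> [_ [x Ax <-]|x Ax] /=; first by rewrite actK.
by exists (phi t^-1%g x) => //; rewrite actVK.
Qed.

Lemma act_image_neq0 t (A : hyperspace X) : phi t @` A !=set0.
Proof. by have [x Ax] := hset_neq0 A; exists (phi t x); exists x. Qed.

Definition hyper_act (t : T) (A : hyperspace X) : hyperspace X :=
  Hyperspace (@act_image_closed t A) (act_image_neq0 t A).

Lemma hyper_act1 A : hyper_act 1%g A = A.
Proof.
apply: hyperspace_eq => /=; apply/seteqP; split=> [_ [x Ax <-]|x Ax].
  by rewrite act1.
by exists x => //; rewrite act1.
Qed.

Lemma hyper_actM s t A : hyper_act (s * t)%g A = hyper_act s (hyper_act t A).
Proof.
apply: hyperspace_eq => /=; apply/seteqP; split=> [_ [x Ax <-]|].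
  by rewrite actM; exists (phi t x) => //; exists x.
by move=> _ [_ [x Ax <-] <-]; rewrite -actM; exists x.
Qed.

Lemma hyper_act_continuous :
  continuous (fun p : discrete_topology T * hyperspace X => hyper_act p.1 p.2).
Proof.
move=> [t A]; apply/vietoris_cvgP => U oU /=.
have oV : open (phi t @^-1` U).
  by apply: open_comp => // x _; exact: act_continuousr.
split=> [AU|[_ [[x Ax <-] Ux]]].
  exists ([set (t : discrete_topology T)], vietoris_contained (phi t @^-1` U)).
    split=> /=; first exact: discrete_set1.
    apply: open_nbhs_nbhs; split; first exact: vietoris_contained_open.
    by move=> x Ax; apply: AU; exists x.
  by move=> [_ B] /= [-> BU] _ [x Bx <-]; exact: BU.
exists ([set (t : discrete_topology T)], vietoris_hit (phi t @^-1` U)).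
  split=> /=; first exact: discrete_set1.
  apply: open_nbhs_nbhs; split; first exact: vietoris_hit_open.
  by exists x.
by move=> [_ B] /= [-> [y [By Uy]]]; exists (phi t y); split=> //; exists y.
Qed.

Definition hyperflow : flow T (hyperspace X) :=
  Flow hyper_act1 hyper_actM hyper_act_continuous
    (hyperspace_compact (act_compact phi)).

End hyperflow.

Definition enveloping (T : groupType) (Y : topologicalType) (phi : flow T Y) :
    set {ptws Y -> Y} :=
  closure [set (phi t : {ptws Y -> Y}) | t in [set: T]].

(* The type C(Y), with the topology of pointwise convergence. The field R[i]
   has no canonical topology in the library; R[i]^o carries that of the
   modulus. *)
Definition Cp (R : realType) (Y : topologicalType) : topologicalType :=
  set_type [set f : {ptws Y -> (R[i])^o} | continuous (f : Y -> (R[i])^o)].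

(* [precompact] is relative to Cp R Y: the closure there is compact. *)
Definition wap (R : realType) (T : groupType) (Y : topologicalType)
    (phi : flow T Y) : Prop :=
  forall g : Cp R Y,
    precompact [set h : Cp R Y | exists t, set_val h = set_val g \o phi t].

Section theta.
Context {R : realType} {X : metricType R} {T : groupType} (phi : flow T X).

Lemma hset1_closed (x : X) : closed [set x].
Proof. exact/accessible_closed_set1/hausdorff_accessible/metric_hausdorff. Qed.

Definition hset1 (x : X) : hyperspace X :=
  Hyperspace (@hset1_closed x) (ex_intro [set x] x erefl).

Lemma enveloping_hset1 (alpha : enveloping (hyperflow phi)) (x : X) :
  exists y, set_val alpha (hset1 x) = hset1 y.
Proof.
have /set_mem alphaE := valP alpha; rewrite set_valE.
set B := (val alpha : {ptws _ -> _}) (hset1 x).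
have [y By] := hset_neq0 B; exists y; apply: hyperspace_eq => /=.
apply/seteqP; split=> [z Bz|_ -> //]; apply/eqP/negPn/negP => zy.
have := @metric_hausdorff _ X; rewrite open_hausdorff => /(_ z y zy).
move=> [[U V] /= [/set_mem Uz /set_mem Vy] [oU oV UV0]].
have evc := @proj_continuous (hyperspace X) (fun=> hyperspace X) (hset1 x)
  (val alpha).
have nU : nbhs B (vietoris_hit U).
  by apply: open_nbhs_nbhs; split; [exact: vietoris_hit_open|exists z].
have nV : nbhs B (vietoris_hit V).
  by apply: open_nbhs_nbhs; split; [exact: vietoris_hit_open|exists y].
have [_ [[t _ <-] [/= [u [tu Uu]] [v [tv Vv]]]]] :=
  alphaE _ (evc _ (filterI nU nV)).
case: tu tv => _ -> uE [_ -> vE]; suff : (U `&` V) u by rewrite (eqP UV0).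
by split=> //; rewrite -uE vE.
Qed.

Definition theta_fun (alpha : enveloping (hyperflow phi)) : {ptws X -> X} :=
  fun x => projT1 (cid (enveloping_hset1 alpha x)).

Lemma theta_funE alpha x :
  set_val alpha (hset1 x) = hset1 (theta_fun alpha x).
Proof. exact: projT2 (cid (enveloping_hset1 alpha x)). Qed.

Lemma theta_enveloping alpha : theta_fun alpha \in enveloping phi.
Proof.
apply/mem_set; rewrite /enveloping closureEcvg.
have alphaE : enveloping (hyperflow phi) (val alpha) := set_mem (valP alpha).
have aE x : (val alpha : {ptws _ -> _}) (hset1 x) = hset1 (theta_fun alpha x).
  exact: theta_funE.
set a := val alpha in alphaE aE *; move: alphaE.
rewrite /enveloping closureEcvg => -[G PG [Galpha EG]].
pose m (beta : {ptws hyperspace X -> hyperspace X}) : {ptws X -> X} :=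
  fun x => projT1 (cid (hset_neq0 (beta (hset1 x)))).
exists (m @ G); first exact: fmap_proper_filter.
split.
  apply/pointwise_cvgP => x V.
  rewrite nbhsE => -[W [oW Wx] WV]; apply: filterS WV _.
  have nW : nbhs ((a : {ptws _ -> _}) (hset1 x)) (vietoris_contained W).
    rewrite aE; apply: open_nbhs_nbhs; split.
      exact: vietoris_contained_open.
    by move=> _ ->.
  have evc := @proj_continuous (hyperspace X) (fun=> hyperspace X) (hset1 x)
    a.
  apply: filterS (Galpha _ (evc _ nW)) => beta /= bW.
  by apply: bW; rewrite /m; case: cid.
move=> P EP; apply: (EG (m @^-1` P)) => _ [t _ <-]; apply: EP.
exists t => //; apply/funext => x; rewrite /m.
by case: cid => _ /= [_ -> <-].
Qed.

Definition Theta (alpha : enveloping (hyperflow phi)) : enveloping phi :=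
  SigSub (theta_enveloping alpha).

Lemma ThetaE alpha x :
  set_val alpha (hset1 x) = hset1 ((set_val (Theta alpha) : {ptws _ -> _}) x).
Proof. by rewrite theta_funE set_valE. Qed.

End theta.

Arguments Theta {R X T} phi alpha.

(* Main.v *)
Require Import Defs.
From mathcomp Require Import all_boot all_order all_algebra.
From mathcomp Require Import all_classical all_reals all_analysis.
From mathcomp Require Import complex.

(** Two facts give the theorem.

    Weak almost periodicity makes the elements of the enveloping semigroup
    continuous after composition with any [g] in C(Y): the closure of the
    orbit of [g] in C(Y) is compact, hence closed in the space of all
    functions on Y, so it already contains every pointwise limit
    [g \o alpha] ([wap_comp_enveloping_continuous]). As C(Y) separates the
    points of a compact Hausdorff space, [alpha] is then determined by its
    values on a dense set ([wap_enveloping_eq]).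

    On 2^X, every [alpha] in the enveloping semigroup commutes with binary
    unions, since each translation does, union is continuous and 2^X is
    Hausdorff ([enveloping_hyper_union]). So the set where [alpha] and [beta]
    agree is stable under unions. If [Theta alpha = Theta beta], it contains
    the singletons, hence the finite sets, and is therefore dense
    ([closure_union_closed]). *)

Set Implicit Arguments.
Unset Strict Implicit.
Unset Printing Implicit Defensive.

Import Order.TTheory GRing.Theory Num.Theory.
Import numFieldNormedType.Exports.

Local Open Scope classical_set_scope.
Local Open Scope ring_scope.

Lemma eq_on_closure (Y Z : topologicalType) (f g : Y -> Z) (S : set Y) :
  hausdorff_space Z -> continuous f -> continuous g ->
  {in S, f =1 g} -> {in closure S, f =1 g}.
Proof.
move=> hZ cf cg fg y /set_mem clSy; apply: hZ => U V fU gV.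
have fyU : nbhs y (f @^-1` U) := cf y U fU.
have gyV : nbhs y (g @^-1` V) := cg y V gV.
have [z [Sz [Uz Vz]]] := clSy _ (filterI fyU gyV).
by exists (f z); split=> //; rewrite fg //; apply/mem_set.
Qed.

Lemma continuous_real_complex (R : realType) :
  continuous (fun x : R => x%:C%C : (R[i])^o).
Proof.
move=> x; apply/cvgrPdist_lt => /= e e0.
have [e1 e1E] : exists e1 : R, e = e1%:C%C.
  exists (complex.Re e).
  by rewrite RRe_real // ger0_real // ltW.
rewrite e1E ltcR in e0 *.
near=> y.
rewrite -rmorphB normc_def /= expr0n /= addr0 sqrtr_sqr ltcR.
by near: y; apply: cvgr_dist_lt.
Unshelve. all: by end_near. Qed.

Lemma ptws_eval_continuous (Y Z : topologicalType) (y : Y) :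
  continuous (fun beta : {ptws Y -> Z} => beta y).
Proof. exact: (@proj_continuous Y (fun=> Z) y). Qed.

Section enveloping_wap.
Context {R : realType} {T : groupType} {Y : topologicalType} (phi : flow T Y).

(** Compactness of the orbit closure is for C(Y), but it passes to the
    Hausdorff space of all functions, where compact sets are closed: taking
    pointwise limits there does not leave C(Y). *)
Lemma wap_comp_enveloping_continuous (g : Y -> (R[i])^o)
    (alpha : {ptws Y -> Y}) :
  wap R phi -> continuous g -> enveloping phi alpha ->
  continuous (g \o alpha : Y -> (R[i])^o).
Proof.
move=> wphi cg Ealpha.
pose G : Cp R Y := SigSub (mem_set cg).
have := wphi G; rewrite precompactE.
set O := [set h | _] => cO.
pose K : set {ptws Y -> (R[i])^o} := set_val @` closure O.
have cK : compact K.
  apply: continuous_compact => //.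
  apply: continuous_subspaceT; exact: initial_continuous.
have clK : closed K.
  apply: compact_closed cK; apply: hausdorff_product => _; exact: norm_hausdorff.
pose L (beta : {ptws Y -> Y}) : {ptws Y -> (R[i])^o} := g \o beta.
have cL : continuous L.
  move=> beta; apply/(@pointwise_cvgP Y _ (L @ nbhs beta)) => y.
  exact: (continuous_comp (@ptws_eval_continuous Y Y y beta) (cg (beta y))).
have clLK : closed (L @^-1` K) by apply: preimage_closed => // b _; exact: cL.
have : (L @^-1` K) alpha.
  move/closure_id: clLK => ->; apply: closureS Ealpha => _ [t _ <-].
  have cgt : continuous (g \o phi t : Y -> (R[i])^o).
    by move=> y; apply: continuous_comp; [exact: act_continuousr|exact: cg].
  exists (SigSub (mem_set cgt) : Cp R Y) => //; apply: subset_closure.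
  by exists t.
by move=> [h _ hE]; move: (set_valP h) => /=; rewrite -[g \o alpha]hE.
Qed.

(** If [alpha] and [beta] differed at [y], a Urysohn function [g] separating
    their values would give two distinct functions [g \o alpha] and
    [g \o beta], which are continuous and agree on a dense set. *)
Lemma wap_enveloping_eq (alpha beta : {ptws Y -> Y}) (D : set Y) :
  hausdorff_space Y -> wap R phi -> enveloping phi alpha ->
  enveloping phi beta -> closure D = setT -> {in D, alpha =1 beta} ->
  alpha = beta.
Proof.
move=> hY wphi Ea Eb dD ab; apply/funext => y; apply: contrapT => nab.
have crY : completely_regular_space Y.
  apply: (@normal_completely_regular R).
    exact: compact_normal hY (act_compact phi).
  exact: hausdorff_accessible.
have clb : closed [set beta y].
  exact/accessible_closed_set1/hausdorff_accessible.
have /(@uniform_separatorP _ R)[f [cf _ f0 f1]] := crY (alpha y) _ clb nab.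
(* Urysohn functions are real; functions in C(Y) are complex. *)
pose g (z : Y) : (R[i])^o := (f z)%:C%C.
have cg : continuous g.
  move=> z; apply: (@continuous_comp _ _ _ f); first exact: cf.
  exact: continuous_real_complex.
have gab : {in closure D, g \o alpha =1 g \o beta}.
  apply: eq_on_closure (@norm_hausdorff _ _) _ _ _.
  - exact: wap_comp_enveloping_continuous.
  - exact: wap_comp_enveloping_continuous.
  - by move=> z Dz /=; rewrite ab.
have /(congr1 (@complex.Re R)) /= : g (alpha y) = g (beta y).
  by apply: gab; rewrite dD; exact/mem_set.
have -> : f (alpha y) = 0 by apply: f0; exists (alpha y).
have -> : f (beta y) = 1 by apply: f1; exists (beta y).
by move/esym/eqP; rewrite oner_eq0.
Qed.

End enveloping_wap.

(** If [x] lies in [A] but not in [B], regularity gives an open set around [x]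
    whose closure misses [B]; hitting the former and being contained in the
    complement of the latter are disjoint conditions. *)
Lemma hyperspace_hausdorff (X : topologicalType) :
  regular_space X -> hausdorff_space (hyperspace X).
Proof.
move=> rX.
have sep (A B : hyperspace X) : cluster (nbhs A) B -> A `<=` B.
  move=> AB x Ax; apply: contrapT => nBx.
  have nx : nbhs x (~` B).
    apply: open_nbhs_nbhs; split=> //.
    by apply: closed_openC; exact: hset_closed.
  have [V Vx VB] := rX x _ nx.
  have nA : nbhs A (vietoris_hit V°).
    apply: open_nbhs_nbhs; split; first exact/vietoris_hit_open/open_interior.
    by exists x.
  have nB : nbhs B (vietoris_contained (~` closure V)).
    apply: open_nbhs_nbhs; split.
      exact/vietoris_contained_open/closed_openC/closed_closure.
    by move=> z Bz /VB; exact.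
  have [C [[z [Cz Vz]] CV]] := AB _ _ nA nB.
  exact: CV Cz (subset_closure (interior_subset Vz)).
move=> A B AB; apply: hyperspace_eq; apply/seteqP; split; first exact: sep.
by apply: sep => U V BU AV; rewrite setIC; exact: AB.
Qed.

Section hyper_union.
Context {X : topologicalType}.
Implicit Types A B : hyperspace X.

Lemma hyper_union_neq0 A B : hset A `|` hset B !=set0.
Proof. by have [x Ax] := hset_neq0 A; exists x; left. Qed.

Definition hyper_union A B : hyperspace X :=
  Hyperspace (closedU (@hset_closed _ A) (@hset_closed _ B))
    (hyper_union_neq0 A B).

Lemma hyper_union_continuous :
  continuous (fun p : hyperspace X * hyperspace X => hyper_union p.1 p.2).
Proof.
move=> [A B]; apply/vietoris_cvgP => U oU /=; split.
  rewrite subUset => -[AU BU].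
  exists (vietoris_contained U, vietoris_contained U).
    split=> /=; apply: open_nbhs_nbhs; split=> //;
      exact: vietoris_contained_open.
  by move=> [C D] /= [CU DU]; rewrite /vietoris_contained /= subUset.
have oH := vietoris_hit_open oU.
move=> [x [[Ax|Bx] Ux]].
- exists (vietoris_hit U, setT) => /=.
    split; last exact: filterT.
    by apply: open_nbhs_nbhs; split=> //; exists x.
  by move=> [C D] /= [[z [Cz Uz]] _]; exists z; split=> //; left.
- exists (setT, vietoris_hit U) => /=.
    split; first exact: filterT.
    by apply: open_nbhs_nbhs; split=> //; exists x.
  by move=> [C D] /= [_ [z [Dz Uz]]]; exists z; split=> //; right.
Qed.

(** The members of [D] inside [A] are directed by union. The corresponding
    sections, the sets of [B] lying between such a member and [A], generate a
    filter that converges to [A]: containment in an open set is inherited from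
    [A], and hitting one is witnessed by a single point of [A]. *)
Lemma closure_union_closed (D : set (hyperspace X)) :
  (forall x, exists2 A, D A & hset A = [set x]) ->
  (forall A B, D A -> D B -> D (hyper_union A B)) ->
  closure D = setT.
Proof.
move=> D1 DU; apply/seteqP; split=> // A _ P AP.
pose F := filter_from [set C | D C /\ C `<=` A]
  (fun C => [set B : hyperspace X | C `<=` B /\ B `<=` A]).
have FF : Filter F.
  apply: filter_from_filter.
    have [x Ax] := hset_neq0 A; have [C DC CE] := D1 x.
    by exists C; split=> //; rewrite CE => _ ->.
  move=> C1 C2 [D1' C1A] [D2' C2A]; exists (hyper_union C1 C2).
    by split; [exact: DU|rewrite /= subUset].
  by move=> B [/=]; rewrite subUset => -[].
have FA : F --> A.
  apply/vietoris_cvgP => U oU; split.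
    move=> AU; have [x Ax] := hset_neq0 A; have [C DC CE] := D1 x.
    exists C; first by split=> //; rewrite CE => _ ->.
    by move=> B [_ BA]; exact: subset_trans BA AU.
  move=> [x [Ax Ux]]; have [C DC CE] := D1 x.
  exists C; first by split=> //; rewrite CE => _ ->.
  by move=> B [CB _]; exists x; split=> //; apply: CB; rewrite CE.
by have [C [DC CA] CP] := FA _ AP; exists C; split=> //; apply: CP; split.
Qed.

(** Both sides are continuous in [alpha] for the pointwise topology, and they
    coincide on the translations. *)
Lemma enveloping_hyper_union (T : groupType) (phi : flow T X)
    (alpha : {ptws hyperspace X -> hyperspace X}) A B :
  hausdorff_space (hyperspace X) -> enveloping (hyperflow phi) alpha ->
  alpha (hyper_union A B) = hyper_union (alpha A) (alpha B).
Proof.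
move=> hX /mem_set; move: alpha; apply: eq_on_closure => //.
- exact: ptws_eval_continuous.
- move=> beta.
  have cAB : {for beta, continuous
      (fun b : {ptws hyperspace X -> hyperspace X} => (b A, b B))}.
    exact: (cvg_pair (@ptws_eval_continuous _ _ A beta)
      (@ptws_eval_continuous _ _ B beta)).
  exact: (continuous_comp cAB (@hyper_union_continuous _)).
- move=> _ /set_mem[t _ <-]; apply: hyperspace_eq => /=.
  by rewrite image_setU.
Qed.

End hyper_union.

Theorem corollary10p1 (R : realType) (X : metricType R) (T : groupType)
    (phi : flow T X) (hwap : wap R (hyperflow phi)) :
  injective (Theta phi).
Proof.
move=> alpha beta ab; apply: val_inj.
have hX : hausdorff_space (hyperspace X).
  exact: hyperspace_hausdorff uniform_regular.
have Ea := set_mem (valP alpha); have Eb := set_mem (valP beta).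
pose D := [set A | (val alpha : {ptws _ -> _}) A = (val beta : {ptws _ -> _}) A].
apply: (wap_enveloping_eq (D := D) hX hwap Ea Eb); last first.
  by move=> A /set_mem.
apply: closure_union_closed => [x|A B DA DB].
  exists (hset1 x) => //; rewrite /D /=.
  by have := ThetaE alpha x; rewrite ab -ThetaE !set_valE.
rewrite /D /= (enveloping_hyper_union _ _ hX Ea).
by rewrite (enveloping_hyper_union _ _ hX Eb) DA DB.
Qed.
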